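(* For $\epsilon\in\{0,1\}$, integers $N>M\ge0$, $r\ge0$ and $\boldsymbol X=(Y_1,X_1,\dots,Y_r,X_r)$, $$\frac{\prod_{i=0}^r\bigl(\langle N\rangle-\langle X_i+Y_{i+1}\rangle\bigr)}{\langle N\rangle-\langle M\rangle}G^\epsilon_{q,M,N+1}(\boldsymbol X)=\sum_{T\in\mathcal T(r)}(-1)^{\mathrm{eo}(T)}\left(\frac{q^N}{\langle N\rangle^\epsilon}\right)^{\kappa(T)}\widetilde G^\epsilon_{q,M,N}(\boldsymbol X_{\setminus T}),$$ where $X_0:=M$ and $Y_{r+1}:=0$ (so $\langle X_0+Y_1\rangle=\langle M\rangle+\langle Y_1\rangle-\langle M\rangle\langle Y_1\rangle$ and $\langle X_r+Y_{r+1}\rangle=\langle X_r\rangle$).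
   Context: For an integer $n$, $\langle n\rangle:=1-q^n$. The symbols $\langle X_i\rangle,\langle Y_i\rangle$ are independent formal variables (standing for $1-q^{X_i}$, $1-q^{Y_i}$), and for symbols $Z,W$ (variables or integers) $\langle Z+W\rangle:=\langle Z\rangle+\langle W\rangle-\langle Z\rangle\langle W\rangle$. Identities are between formal power series in these variables with coefficients in $\mathbb Q((q))$, where denominators are invertible. Let $\bar1$ be a formal symbol. For integers $N>M\ge0$ and $\boldsymbol k=(k_1,\dots,k_r)$ with entries in $\{\bar1\}\cup\mathbb Z_{\ge1}$, $k_r\ne\bar1$: $\zeta_{q,M,N}^\dagger(\boldsymbol k)=\sum_{M<n_1\le\cdots\le n_r<N,\ n_i<n_{i+1}\text{ whenever }k_i\ne\bar1}\big(\prod_{j:k_j=\bar1}\langle N-n_j\rangle^{-1}\big)\big(\prod_{j:k_j\ne\bar1}q^{n_j}\langle n_j\rangle^{-k_j}\big)$; for $\boldsymbol k\in\mathbb Z_{\ge1}^r$ with $k_r\ge2$: $\zeta_{q,M,N}^{\diamondsuit,\dagger}(\boldsymbol k)=\sum_{A\subset\{i:k_i=1\}}\sum_{M<n_1\le\cdots\le n_r<N,\ n_i<n_{i+1}\ (i\notin A)}\big(\prod_{i\in A}\langle N-n_i\rangle^{-1}\big)\big(\prod_{i\notin A}q^{n_i}\langle n_i\rangle^{-k_i}\big)$ (empty tuple gives $1$). Put $\xi^0_{q,M,N}(l_1,k_1,\dots,l_r,k_r)=\zeta^\dagger_{q,M,N}(\{\bar1\}^{l_1-1},k_1,\dots,\{\bar1\}^{l_r-1},k_r)$,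 $\xi^1_{q,M,N}(l_1,k_1,\dots,l_r,k_r)=\zeta^{\diamondsuit,\dagger}_{q,M,N}(\{1\}^{l_1-1},k_1+1,\dots,\{1\}^{l_r-1},k_r+1)$ ($\{a\}^m$ = $m$ repetitions of $a$). Define $G^\epsilon_{q,M,N}(Y_1,X_1,\dots,Y_r,X_r)=\sum_{k_j,l_j\ge0}\big(\prod_{j=1}^r\langle Y_j\rangle^{l_j}\langle X_j\rangle^{k_j}\big)\xi^\epsilon_{q,M,N}(l_1+1,k_1+1,\dots,l_r+1,k_r+1)$ and $\widetilde G^\epsilon_{q,M,N}(Y_1,X_1,\dots,Y_r,X_r)=\prod_{i=1}^r(\langle N\rangle-\langle X_i+Y_i\rangle)\,G^\epsilon_{q,M,N}(Y_1,X_1,\dots,Y_r,X_r)$ (both equal $1$ for $r=0$). Combinatorics: $[n]=\{1,\dots,n\}$; $\mathrm{eo}(S)=\#\{j\ge1:\{2j,2j+1\}\subset S\}$. $\mathrm{EO}(r)$ = sets $\bigcup_{j\in R}\{2j,2j+1\}$, $R\subset[r-1]$; $\mathrm{OE}(r)$ = sets $\bigcup_{j\in R}\{2j-1,2j\}$, $R\subset[r]$; $\mathrm{OE}^*(r)=\{S\in\mathrm{OE}(r):|i-j|\ne2\ \forall i,j\in S\}$; $\mathcal T(r)=\{S\cup S':S\in\mathrm{EO}(r),S'\in\mathrm{OE}^*(r),S\cap S'=\emptyset\}$; $\kappa(T)=\#T/2$. For a sequence $(W_1,\dots,W_{2r})$ and $T\subset[2r]$, $(W_1,\dots,W_{2r})_{\setminus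 T}$ is the sequence with entries indexed by $T$ deleted; for $T\in\mathcal T(r)$, $\boldsymbol X_{\setminus T}$ is again of the form $(Y'_1,X'_1,\dots,Y'_{r'},X'_{r'})$ and $\widetilde G$ is applied to it in that way. *)

(* Defs.v *)
From HB Require Import structures.
From mathcomp Require Import all_boot all_order all_algebra.
From mathcomp Require Import fraction boolp.
From mathcomp Require Import mpoly.

Set Implicit Arguments.
Unset Strict Implicit.
Unset Printing Implicit Defensive.

Import Order.TTheory GRing.Theory.
Local Open Scope ring_scope.

(* Formal power series over R in n commuting variables, as families of
   coefficients indexed by the exponents 'X_{1..n} of multinomials. *)
Record fps (n : nat) (R : Type) := FPS { fcoef : 'X_{1..n} -> R }.

HB.instance Definition _ (n : nat) (R : Type) := gen_eqMixin (fps n R).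
HB.instance Definition _ (n : nat) (R : Type) := gen_choiceMixin (fps n R).

Lemma fpsP (n : nat) (R : Type) (f g : fps n R) :
  (forall m, fcoef f m = fcoef g m) -> f = g.
Proof. by case: f g => [f] [g] /= /funext ->. Qed.

Section FpsRing.
Variables (n : nat) (R : comNzRingType).
Implicit Types (f g h : fps n R) (m : 'X_{1..n}).

Definition fps_zero : fps n R := FPS (fun=> 0).
Definition fps_opp f : fps n R := FPS (fun m => - fcoef f m).
Definition fps_add f g : fps n R := FPS (fun m => fcoef f m + fcoef g m).

Fact fps_addA : associative fps_add.
Proof. by move=> f g h; apply: fpsP => m /=; rewrite addrA. Qed.
Fact fps_addC : commutative fps_add.
Proof. by move=> f g; apply: fpsP => m /=; rewrite addrC. Qed.
Fact fps_add0 : left_id fps_zero fps_add.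
Proof. by move=> f; apply: fpsP => m /=; rewrite add0r. Qed.
Fact fps_addN : left_inverse fps_zero fps_opp fps_add.
Proof. by move=> f; apply: fpsP => m /=; rewrite addNr. Qed.

HB.instance Definition _ := GRing.isZmodule.Build (fps n R)
  fps_addA fps_addC fps_add0 fps_addN.

Definition fps_one : fps n R := FPS (fun m => (m == 0%MM)%:R).
Definition fps_mul f g : fps n R := FPS (fun m =>
  \sum_(k : 'X_{1..n < (mdeg m).+1, (mdeg m).+1} | m == (k.1 + k.2)%MM)
     fcoef f k.1 * fcoef g k.2).

Definition fps_trunc d f : {mpoly R[n]} :=
  \sum_(m : 'X_{1..n < d}) fcoef f m *: 'X_[m].

Lemma mcoeff_trunc d f m :
  (mdeg m < d)%N -> (fps_trunc d f)@_m = fcoef f m.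
Proof.
move=> md; rewrite /fps_trunc raddf_sum /= (bigD1 (BMultinom md)) //=.
rewrite mcoeffZ mcoeffX eqxx mulr1 big1 ?addr0 // => k kn.
rewrite mcoeffZ mcoeffX; case: eqP => [e|]; last by rewrite mulr0.
by case/eqP: kn; apply: val_inj.
Qed.

Lemma mcoeffM_eq (p p' r r' : {mpoly R[n]}) m :
  (forall k, (mdeg k <= mdeg m)%N -> p@_k = p'@_k) ->
  (forall k, (mdeg k <= mdeg m)%N -> r@_k = r'@_k) ->
  (p * r)@_m = (p' * r')@_m.
Proof.
move=> Hp Hr; rewrite !mcoeffM; apply: eq_bigr => k _.
by rewrite Hp ?Hr // -ltnS bmdeg.
Qed.

Lemma fcoef_mul_trunc d f g m : (mdeg m < d)%N ->
  fcoef (fps_mul f g) m = (fps_trunc d f * fps_trunc d g)@_m.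
Proof.
move=> md; rewrite mcoeffM /=; apply: eq_bigr => k _.
by rewrite !mcoeff_trunc //; apply: leq_trans md; apply: bmdeg.
Qed.

Lemma mcoeff_trunc_mul d f g m : (mdeg m < d)%N ->
  (fps_trunc d (fps_mul f g))@_m = (fps_trunc d f * fps_trunc d g)@_m.
Proof. by move=> md; rewrite mcoeff_trunc // (fcoef_mul_trunc _ _ md). Qed.

Fact fps_mulA : associative fps_mul.
Proof.
move=> f g h; apply: fpsP => m.
have md := ltnSn (mdeg m).
rewrite !(fcoef_mul_trunc _ _ md).
transitivity ((fps_trunc (mdeg m).+1 f * fps_trunc (mdeg m).+1 g *
               fps_trunc (mdeg m).+1 h)@_m).
  by rewrite -mulrA; apply: mcoeffM_eq => // k km; rewrite mcoeff_trunc_mul.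
by apply: mcoeffM_eq => // k km; rewrite mcoeff_trunc_mul.
Qed.

Fact fps_mulC : commutative fps_mul.
Proof.
move=> f g; apply: fpsP => m; have md := ltnSn (mdeg m).
by rewrite !(fcoef_mul_trunc _ _ md) mulrC.
Qed.

Fact fps_mul1 : left_id fps_one fps_mul.
Proof.
move=> f; apply: fpsP => m; have md := ltnSn (mdeg m).
rewrite (fcoef_mul_trunc _ _ md) -[RHS](mcoeff_trunc f md).
rewrite -[X in _ = X@_m]mul1r; apply: mcoeffM_eq => // k km.
by rewrite mcoeff_trunc // mcoeff1.
Qed.

Fact fps_mulDl : left_distributive fps_mul fps_add.
Proof.
move=> f g h; apply: fpsP => m /=; rewrite -big_split /=.
by apply: eq_bigr => k _; rewrite mulrDl.
Qed.

Fact fps_one_neq0 : fps_one != fps_zero.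
Proof.
apply/eqP => /(congr1 (fun f => fcoef f 0%MM)) /= /eqP.
by rewrite eqxx oner_eq0.
Qed.

HB.instance Definition _ := GRing.Zmodule_isComNzRing.Build (fps n R)
  fps_mulA fps_mulC fps_mul1 fps_mulDl fps_one_neq0.

Definition fps_scale (c : R) f : fps n R := FPS (fun m => c * fcoef f m).

Fact fps_scaleA a b f : fps_scale a (fps_scale b f) = fps_scale (a * b) f.
Proof. by apply: fpsP => m /=; rewrite mulrA. Qed.
Fact fps_scale1 : left_id 1 fps_scale.
Proof. by move=> f; apply: fpsP => m /=; rewrite mul1r. Qed.
Fact fps_scaleDr : right_distributive fps_scale +%R.
Proof. by move=> a f g; apply: fpsP => m /=; rewrite mulrDr. Qed.
Fact fps_scaleDl f : {morph fps_scale^~ f : a b / a + b}.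
Proof. by move=> a b; apply: fpsP => m /=; rewrite mulrDl. Qed.

HB.instance Definition _ := GRing.Zmodule_isLmodule.Build R (fps n R)
  fps_scaleA fps_scale1 fps_scaleDr fps_scaleDl.

Fact fps_scaleAl (c : R) (f g : fps n R) : c *: (f * g) = c *: f * g.
Proof.
apply: fpsP => m /=; rewrite mulr_sumr.
by apply: eq_bigr => k _; rewrite mulrA.
Qed.

HB.instance Definition _ := GRing.Lmodule_isLalgebra.Build R (fps n R)
  fps_scaleAl.
HB.instance Definition _ := GRing.Lalgebra_isComAlgebra.Build R (fps n R).

Definition fps_var (i : 'I_n) : fps n R := FPS (fun m => (m == U_(i)%MM)%:R).

(* The inverse is chosen classically; it is only needed to view fps n R as an
   integral domain in the sense of the algebraic hierarchy. *)
Definition fps_unit : {pred fps n R} := fun f => `[< exists g, g * f = 1 >].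
Definition fps_inv f : fps n R :=
  match pselect (exists g, g * f = 1) with
  | left fu => projT1 (cid fu)
  | right _ => f
  end.

Fact fps_mulVr : {in fps_unit, left_inverse 1 fps_inv *%R}.
Proof.
move=> f /asboolP fu; rewrite /fps_inv; case: pselect => // fu'.
by case: (cid fu').
Qed.
Fact fps_unitP f g : g * f = 1 -> fps_unit f.
Proof. by move=> gf; apply/asboolP; exists g. Qed.
Fact fps_inv_out : {in [predC fps_unit], fps_inv =1 id}.
Proof.
by move=> f /asboolPn fu; rewrite /fps_inv; case: pselect.
Qed.

HB.instance Definition _ := GRing.ComNzRing_hasMulInverse.Build (fps n R)
  fps_mulVr fps_unitP fps_inv_out.

End FpsRing.

Arguments fps_var {n R} i.

Section FpsDomain.
Variables (n : nat) (R : idomainType).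

Lemma fps_lowest (f : fps n R) : f != 0 ->
  exists2 m, fcoef f m != 0 & forall k, (k < m)%O -> fcoef f k = 0.
Proof.
move=> f0; apply: contrapT => H; case/eqP: f0; apply: fpsP => m /=.
elim/(well_founded_ind (@ltom_wf n)): m => m IH.
by apply/eqP; apply: contrapT => /negP fm; apply: H; exists m.
Qed.

Fact fps_mul_eq0 (f g : fps n R) : f * g = 0 -> (f == 0) || (g == 0).
Proof.
move=> fg0; apply: contraPT fg0; rewrite negb_or.
case/andP => /fps_lowest [a fa Ha] /fps_lowest [b gb Hb].
move/(congr1 (fun h => fcoef h (a + b)%MM)) => /=.
have ha : (mdeg a < (mdeg (a + b)).+1)%N by rewrite mdegD ltnS leq_addr.
have hb : (mdeg b < (mdeg (a + b)).+1)%N by rewrite mdegD ltnS leq_addl.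
rewrite (bigD1 (BMultinom ha, BMultinom hb)) //= big1 ?addr0.
  by move/eqP; rewrite mulf_eq0 (negPf fa) (negPf gb).
case=> [[k kd] [l ld]] /= /andP[/eqP e ne].
have [ka|ak|ka] := ltgtP k a; first by rewrite Ha // mul0r.
- have [lb|bl|lb] := ltgtP l b; first by rewrite Hb // mulr0.
  + by have := ltm_add ak bl; rewrite e ltxx.
  + by move: e; rewrite lb => /addIm ka; move: ak; rewrite ka ltxx.
- have lb : b = l by move: e; rewrite ka => /addmI.
  by case/eqP: ne; congr pair; apply: val_inj.
Qed.

HB.instance Definition _ := GRing.ComUnitRing_isIntegral.Build (fps n R)
  fps_mul_eq0.
End FpsDomain.

(* Q((q)) as the field of fractions of Q[[q]]. *)
Definition Qq : fieldType := {fraction fps 1 rat}.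
Definition qvar : Qq := tofrac (fps_var ord0).

(* The formal sum of a(e) * prod_j W_j^e_j over all exponent sequences e, for
   series W_j without constant term: a term in which some e_j exceeds the
   degree of m does not contribute to the coefficient at m. *)
Definition fps_eval (n : nat) (R : comNzRingType) (a : seq nat -> R)
    (W : seq (fps n R)) : fps n R :=
  FPS (fun m => fcoef
    (\sum_(e : (size W).-tuple 'I_(mdeg m).+1)
       a [seq val x | x <- e] *: \prod_(j < size W) W`_j ^+ tnth e j) m).

Section Values.
Variables (K : fieldType) (q : K).

Definition br (n : nat) : K := 1 - q ^+ n.

(* M < n_1 <= ... <= n_r < N, with n_i < n_(i+1) unless i is in A *)
Definition admissible (M N r : nat) (A : {set 'I_r}) (n : {ffun 'I_r -> 'I_N})
  : bool :=
  [forall i : 'I_r, (M < n i)%N] &&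
  [forall i : 'I_r, forall j : 'I_r, (j == i.+1 :> nat) ==>
     (if i \in A then n i <= n j else n i < n j)%N].

Definition zeta_sum (M N r : nat) (A : {set 'I_r}) (k : 'I_r -> nat) : K :=
  \sum_(n : {ffun 'I_r -> 'I_N} | admissible M A n)
    (\prod_(i in A) (br (N - n i))^-1) *
    (\prod_(i in ~: A) (q ^+ n i * br (n i) ^- k i)).

(* Tuples with entries in {bar 1} together with the positive integers *)
Inductive entry := Bar1 | Int of nat.
Definition is_bar (x : entry) : bool := if x is Bar1 then true else false.
(* The value at Bar1 is never used. *)
Definition int_part (x : entry) : nat := if x is Int k then k else 0%N.

Definition zeta_dag (M N : nat) (k : seq entry) : K :=
  zeta_sum M N [set i : 'I_(size k) | is_bar (nth Bar1 k i)]
    (fun i => int_part (nth Bar1 k i)).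

Definition zeta_diamond (M N : nat) (k : seq nat) : K :=
  \sum_(A : {set 'I_(size k)} | A \subset [set i : 'I_(size k) | nth 0%N k i == 1%N])
    zeta_sum M N A (fun i => nth 0%N k i).

(* The sequence s is (l_1, k_1, ..., l_r, k_r). *)
Fixpoint args0 (s : seq nat) : seq entry :=
  if s is l :: k :: s' then nseq l.-1 Bar1 ++ Int k :: args0 s' else [::].
Fixpoint args1 (s : seq nat) : seq nat :=
  if s is l :: k :: s' then nseq l.-1 1%N ++ k.+1 :: args1 s' else [::].

(* A superscript epsilon in {0, 1} is a boolean: false is 0, true is 1. *)
Definition xi (eps : bool) (M N : nat) (s : seq nat) : K :=
  if eps then zeta_diamond M N (args1 s) else zeta_dag M N (args0 s).

Definition br_const (n d : nat) : fps n K := (br d)%:A.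

(* <Z + W> in terms of z = <Z> and w = <W> *)
Definition br_add (n : nat) (z w : fps n K) : fps n K := z + w - z * w.

(* In G and Gt, W is the sequence (<Y_1>, <X_1>, ..., <Y_r>, <X_r>). *)
Definition G (n : nat) (eps : bool) (M N : nat) (W : seq (fps n K)) : fps n K :=
  fps_eval (fun e => xi eps M N [seq x.+1 | x <- e]) W.

Definition Gt (n : nat) (eps : bool) (M N : nat) (W : seq (fps n K)) : fps n K :=
  (\prod_(i < (size W)./2)
     (br_const n N - br_add W`_((i.*2).+1) W`_(i.*2))) * G eps M N W.

End Values.

Section Combinatorics.
Variable r : nat.

(* The element i of 'I_(r.*2) stands for the label i + 1 of [2r]. *)
Definition labels (s : seq nat) : {set 'I_(r.*2)} :=
  [set i : 'I_(r.*2) | i.+1 \in s].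

Definition EO : {set {set 'I_(r.*2)}} :=
  [set \bigcup_(j in R) labels [:: j.*2; (j.*2).+1]
     | R : {set 'I_r} & [forall j in R, (0 < val j)%N]].

Definition OE : {set {set 'I_(r.*2)}} :=
  [set \bigcup_(j in R) labels [:: (j.*2).-1; j.*2]
     | R : {set 'I_r.+1} & [forall j in R, (0 < val j)%N]].

Definition OEstar : {set {set 'I_(r.*2)}} :=
  [set S in OE | [forall i in S, forall j in S, (j != i.+2 :> nat)]].

Definition calT : {set {set 'I_(r.*2)}} :=
  [set S :|: S' | S in EO, S' in OEstar & S :&: S' == set0].

Definition eo (S : {set 'I_(r.*2)}) : nat :=
  #|[set j : 'I_r | (0 < j)%N && (labels [:: j.*2; (j.*2).+1] \subset S)]|.

Definition kappa (T : {set 'I_(r.*2)}) : nat := #|T|./2.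

Definition delete (V : Type) (W : 'I_(r.*2) -> V) (T : {set 'I_(r.*2)})
  : seq V := [seq W i | i <- enum 'I_(r.*2) & i \notin T].

End Combinatorics.

(* Main.v *)
From HB Require Import structures.
Require Import Defs.
From mathcomp Require Import all_boot all_order all_algebra.
From mathcomp Require Import fraction boolp mpoly.
From mathcomp Require Import ring zify.
Import GRing.Theory.
Local Open Scope ring_scope.

Set Implicit Arguments.
Unset Strict Implicit.
Unset Printing Implicit Defensive.

(* Peeling off the smallest summation index gives, with u = q^(M+1), y = 1 - Y
   and x = 1 - X,
     G_N(M; Y, X, W) = a(Y) (b(Y) G_N(M+1; Y, X, W) + w(X) G_N(M+1; W)),
   where a(Y) = (u - q^N) / (u y - q^N), b(Y) = ((1 - u y) / (1 - u))^eps and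
   w(X) = u / ((1 - u)^eps (x - u)); for G_(N+1) only a changes, to its value at
   q^M.  Hence both sides of the theorem can be compared by descending induction
   on M.  With c = q^N and C = c / (1 - c)^eps, the exchange identity
     (x y' - c) w(X) a(Y') =
       a(Y) (x y - c) w(X) + C (a(Y') b(Y') - a(Y) b(Y))
   shows that the left-hand side L satisfies
     L(Y, X, Y', X', W) = K + C L(Y', X', W) - C L(Y, X', W),
   K being the contribution of the sequences starting with Y, X.  Iterating this
   deletes adjacent pairs of variables: a pair Y_j, X_j with weight C, a pair
   X_j, Y_(j+1) with weight -C.  Two consecutive pairs Y_j, X_j and Y_(j+1),
   X_(j+1) are deleted in two ways with opposite signs, so exactly the sets in
   T(r) survive. *)

(** * Truncation of power series by degree, and evaluation of formal sums *)

Section Truncation.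
Variables (n : nat) (R : comNzRingType).
Implicit Types (f g w : fps n R) (m : 'X_{1..n}) (W : seq (fps n R)).

Lemma fcoefD f g m : fcoef (f + g) m = fcoef f m + fcoef g m.
Proof. by []. Qed.

Lemma fcoefN f m : fcoef (- f) m = - fcoef f m.
Proof. by []. Qed.

Lemma fcoefZ (c : R) f m : fcoef (c *: f) m = c * fcoef f m.
Proof. by []. Qed.

Lemma fcoef1 m : fcoef (1 : fps n R) m = (m == 0%MM)%:R.
Proof. by []. Qed.

Lemma fcoef0 m : fcoef (0 : fps n R) m = 0.
Proof. by []. Qed.

Lemma fcoefM f g m : fcoef (f * g) m =
  \sum_(k : 'X_{1..n < (mdeg m).+1, (mdeg m).+1} | m == (k.1 + k.2)%MM)
     fcoef f k.1 * fcoef g k.2.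
Proof. by []. Qed.

Definition order_ge (d : nat) f := forall m, (mdeg m < d)%N -> fcoef f m = 0.

(** Congruence modulo the d-th power of the ideal generated by the variables; modulo these powers
    the infinite sum [fps_eval] is compared with finite ones. *)
Definition eq_upto (d : nat) f g := order_ge d (f - g).

Lemma order_ge_le d e f : (d <= e)%N -> order_ge e f -> order_ge d f.
Proof. by move=> de fe m md; apply: fe; apply: leq_trans de. Qed.

Lemma order_geD d f g : order_ge d f -> order_ge d g -> order_ge d (f + g).
Proof. by move=> fd gd m md; rewrite fcoefD fd ?gd ?addr0. Qed.

Lemma order_geN d f : order_ge d f -> order_ge d (- f).
Proof. by move=> fd m md; rewrite fcoefN fd ?oppr0. Qed.

Lemma order_geM d e f g :
  order_ge d f -> order_ge e g -> order_ge (d + e) (f * g).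
Proof.
move=> fd ge m md; rewrite fcoefM big1 // => k /eqP mk.
have [kd|dk] := ltnP (mdeg k.1) d; first by rewrite fd ?mul0r.
rewrite ge ?mulr0 // -(ltn_add2l (mdeg k.1)) -mdegD -mk.
by apply: leq_trans md _; rewrite leq_add2r.
Qed.

Lemma order_geX w d : order_ge 1 w -> order_ge d (w ^+ d).
Proof.
move=> w1; elim: d => [|d IH]; first by move=> m; rewrite ltn0.
by rewrite exprS -add1n; apply: order_geM.
Qed.

Lemma eq_upto_refl d f : eq_upto d f f.
Proof. by rewrite /eq_upto subrr. Qed.

Lemma eq_upto_trans d f g h : eq_upto d f g -> eq_upto d g h -> eq_upto d f h.
Proof. by move=> fg gh; rewrite /eq_upto -(subrKA g); apply: order_geD. Qed.

Lemma eq_upto_sym d f g : eq_upto d f g -> eq_upto d g f.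
Proof. by rewrite /eq_upto -(opprB f g); apply: order_geN. Qed.

Lemma eq_uptoD d f f' g g' :
  eq_upto d f f' -> eq_upto d g g' -> eq_upto d (f + g) (f' + g').
Proof. by move=> ff gg; rewrite /eq_upto opprD addrACA; apply: order_geD. Qed.

Lemma eq_uptoM d h f g : eq_upto d f g -> eq_upto d (h * f) (h * g).
Proof.
move=> fg; rewrite /eq_upto -mulrBr -(add0n d); exact: order_geM.
Qed.

Lemma eq_uptoP f g : (forall d, eq_upto d f g) -> f = g.
Proof.
move=> fg; apply: fpsP => m; apply/eqP; rewrite -subr_eq0; apply/eqP.
by apply: (fg (mdeg m).+1 m).
Qed.

(** The finite sums inside [fps_eval], nested so that the first variable can be split off. *)
Fixpoint partial_eval (d : nat) (a : seq nat -> R) W : fps n R :=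
  if W is w :: W' then
    \sum_(l < d) w ^+ l * partial_eval d (fun e => a (val l :: e)) W'
  else (a [::])%:A.

Lemma partial_evalE d a W : partial_eval d a W =
  \sum_(e : (size W).-tuple 'I_d)
     a [seq val x | x <- e] *: \prod_(j < size W) W`_j ^+ tnth e j.
Proof.
elim: W a => [|w W IH] a.
  rewrite (bigD1 [tuple]) //= big_ord0 big1 ?addr0 // => e.
  by case/eqP; apply: tuple0.
rewrite [LHS]/= (reindex (fun p : 'I_d * (size W).-tuple 'I_d =>
  [tuple of p.1 :: p.2])) /=; last first.
  exists (fun e => (thead e, [tuple of behead e])) => [[l e]|e] _ /=.
    by congr pair; apply: val_inj.
  by rewrite [RHS]tuple_eta.
rewrite -(pair_bigA _ (fun (l : 'I_d) (e : (size W).-tuple 'I_d) =>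
  a (val l :: [seq val x | x <- e]) *:
  \prod_(j < (size W).+1) (w :: W)`_j ^+ tnth [tuple of l :: val e] j)) /=.
apply: eq_bigr => l _; rewrite IH mulr_sumr; apply: eq_bigr => e _.
rewrite big_ord_recl /= -scalerAr (tnth_nth l) /=; congr (_ *: (_ * _)).
by apply: eq_bigr => j _; rewrite !(tnth_nth l).
Qed.

Lemma eq_upto_sum d k (F G : 'I_k -> fps n R) :
  (forall l, eq_upto d (F l) (G l)) ->
  eq_upto d (\sum_(l < k) F l) (\sum_(l < k) G l).
Proof.
move=> FG; rewrite /eq_upto -sumrB; apply: (big_ind (order_ge d)) => //.
  exact: order_geD.
by move=> l _; apply: FG.
Qed.

(** Every additional term has some exponent at least d, hence order at least d, because the series
    in W have no constant term. *)
Lemma partial_eval_stable d k a W : (forall w, w \in W -> order_ge 1 w) ->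
  eq_upto d (partial_eval d a W) (partial_eval (d + k) a W).
Proof.
elim: W a => [|w W IH] a W1 /=; first exact: eq_upto_refl.
have W1' v : v \in W -> order_ge 1 v.
  by move=> vW; apply: W1; rewrite inE vW orbT.
rewrite big_split_ord /= -[X in eq_upto _ X _]addr0; apply: eq_uptoD.
  by apply: eq_upto_sum => l; apply: eq_uptoM; apply: IH.
apply: eq_upto_sym; rewrite /eq_upto subr0.
apply: (big_ind (order_ge d)) => //; first exact: order_geD.
move=> l _; apply: (@order_ge_le d (d + l + 0)).
  by rewrite addn0 leq_addr.
by apply: order_geM => //; apply: order_geX; apply: W1; rewrite mem_head.
Qed.

Lemma fps_eval_partial d a W : (forall w, w \in W -> order_ge 1 w) ->
  eq_upto d (fps_eval a W) (partial_eval d a W).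
Proof.
move=> W1 m md; rewrite fcoefD fcoefN /= -partial_evalE -(subnKC md).
have := @partial_eval_stable (mdeg m).+1 (d - (mdeg m).+1) a W W1 m (leqnn _).
by [].
Qed.

Lemma eq_fps_eval a b W : (forall e, size e = size W -> a e = b e) ->
  fps_eval a W = fps_eval b W.
Proof.
move=> ab; apply: fpsP => m /=; congr (fcoef _ m).
by apply: eq_bigr => e _; rewrite ab // size_map size_tuple.
Qed.

Lemma fps_evalD a b W :
  fps_eval (fun e => a e + b e) W = fps_eval a W + fps_eval b W.
Proof.
apply: fpsP => m; rewrite fcoefD /= -fcoefD -big_split /=; congr (fcoef _ m).
by apply: eq_bigr => e _; rewrite scalerDl.
Qed.

Lemma fps_evalZ c a W : fps_eval (fun e => c * a e) W = c *: fps_eval a W.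
Proof.
apply: fpsP => m; rewrite fcoefZ /= -fcoefZ scaler_sumr; congr (fcoef _ m).
by apply: eq_bigr => e _; rewrite scalerA.
Qed.

Lemma fps_eval_nil (a : seq nat -> R) :
  fps_eval a [::] = (a [::])%:A :> fps n R.
Proof.
apply: fpsP => m; rewrite /= (bigD1 [tuple]) //= big_ord0 big1 ?addr0 // => e.
by case/eqP; apply: tuple0.
Qed.

(** The exponent of w is zero or positive, and in the second case a factor w comes out. This turns
    recursions of coefficients into equations between generating series. *)
Lemma fps_eval_cons a w W : (forall v, v \in w :: W -> order_ge 1 v) ->
  fps_eval a (w :: W) = fps_eval (fun e => a (0%N :: e)) W
    + w * fps_eval (fun e => a ((head 0%N e).+1 :: behead e)) (w :: W).
Proof.
move=> W1; have W1' v : v \in W -> order_ge 1 v.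
  by move=> vW; apply: W1; rewrite inE vW orbT.
apply: eq_uptoP => d.
(* Truncating at d + 1 leaves d exponents once the exponent 0 is removed, as many as in the
   truncation at d used for the last term. *)
have h := @fps_eval_partial d.+1 a _ W1.
apply: eq_upto_trans (order_ge_le (leqnSn d) h) _.
rewrite [partial_eval _ _ _]/= big_ord_recl expr0 mul1r; apply: eq_uptoD.
  apply: eq_upto_sym; apply: (@order_ge_le d d.+1) => //.
  exact: fps_eval_partial.
apply: eq_upto_sym.
apply: eq_upto_trans (eq_uptoM w (@fps_eval_partial d _ _ W1)) _.
rewrite [partial_eval _ _ _]/= mulr_sumr; apply: eq_upto_sum => l.
rewrite lift0 exprS -mulrA; do 2!apply: eq_uptoM.
have := @partial_eval_stable d 1 (fun e => a (l.+1 :: e)) W W1'.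
by rewrite addn1.
Qed.

Lemma order_ge_fps_var i : order_ge 1 (fps_var i : fps n R).
Proof.
move=> m; rewrite ltnS leqn0 mdeg_eq0 => /eqP-> /=.
case: eqP => // /(congr1 mdeg); by rewrite mdeg0 mdeg1.
Qed.

End Truncation.

(** * Subsets of positions, split at the first position *)

Section ConsSet.
Variable r : nat.

Definition cons_set (b : bool) (A : {set 'I_r}) : {set 'I_r.+1} :=
  [set i | if unlift ord0 i is Some j then j \in A else b].

Definition tail_set (A : {set 'I_r.+1}) : {set 'I_r} :=
  [set j | lift ord0 j \in A].

Lemma in_cons_set0 b A : (ord0 \in cons_set b A) = b.
Proof. by rewrite inE unlift_none. Qed.

Lemma in_cons_setS b A j : (lift ord0 j \in cons_set b A) = (j \in A).
Proof. by rewrite inE liftK. Qed.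

Lemma cons_setK b : cancel (cons_set b) tail_set.
Proof. by move=> A; apply/setP => j; rewrite inE in_cons_setS. Qed.

Lemma cons_set_tail (A : {set 'I_r.+1}) :
  cons_set (ord0 \in A) (tail_set A) = A.
Proof.
apply/setP => i; case: (unliftP ord0 i) => [j|] ->.
  by rewrite in_cons_setS inE.
by rewrite in_cons_set0.
Qed.

Lemma big_cons_set (R : nmodType) (f : {set 'I_r.+1} -> R) :
  \sum_A f A = \sum_A f (cons_set false A) + \sum_A f (cons_set true A).
Proof.
have H b : \sum_(A : {set 'I_r.+1} | (ord0 \in A) == b) f A =
    \sum_A f (cons_set b A).
  rewrite (reindex_onto (cons_set b) tail_set) /=.
    by apply: eq_bigl => A; rewrite in_cons_set0 cons_setK !eqxx.
  by move=> A /eqP e; rewrite -[RHS]cons_set_tail e.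
rewrite (bigID (fun A : {set 'I_r.+1} => ord0 \in A)) addrC -!H /=.
by congr (_ + _); apply: eq_bigl => A; case: (ord0 \in A).
Qed.

End ConsSet.

(** * Splitting off the smallest summation index in the zeta sums *)

Section Peel.
Variables (K : fieldType) (q : K).

(** If position 0 lies in A, the next index may equal n_1, that is, exceed n_1 - 1; since M < n_1,
    the truncated predecessor is the true one. *)
Lemma admissible_cons M N r (A : {set 'I_r.+1}) (n : {ffun 'I_r.+1 -> 'I_N}) :
  admissible M A n = (M < n ord0)%N &&
    admissible (if ord0 \in A then (n ord0).-1 else n ord0) (tail_set A)
      [ffun j => n (lift ord0 j)].
Proof.
apply/andP/and3P.
  case=> /forallP nM /forallP H; have {}H (i j : 'I_r.+1) : j = i.+1 :> nat ->
      (if i \in A then n i <= n j else n i < n j)%N.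
    by move=> ij; have /forallP/(_ j) := H i; rewrite ij eqxx.
  split=> //; last first.
    apply/forallP=> i; apply/forallP=> j; apply/implyP => /eqP ij.
    by rewrite !ffunE inE; apply: H; rewrite !lift0 ij.
  apply/forallP; case=> j; elim: j => [|j IH] jr; rewrite ffunE.
    have := H ord0 (lift ord0 (Ordinal jr)) erefl.
    by have := nM ord0; case: ifP; lia.
  have {}IH := IH (ltnW jr); rewrite ffunE in IH.
  have := H (lift ord0 (Ordinal (ltnW jr))) (lift ord0 (Ordinal jr)) erefl.
  by move: IH; do 2!case: ifP; lia.
case=> M0 /forallP nM /forallP H; split.
  apply/forallP=> i; case: (unliftP ord0 i) => [j|] -> //.
  by have := nM j; rewrite ffunE; case: ifP; lia.
apply/forallP=> i; apply/forallP=> j; apply/implyP => /eqP.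
case: (unliftP ord0 j) => [j'|] -> //; rewrite lift0 => -[].
case: (unliftP ord0 i) => [i'|] -> /= ij.
  have /forallP/(_ j') := H i'; rewrite !ffunE inE.
  by rewrite ij eqxx.
by have := nM j'; rewrite ffunE; case: ifP; lia.
Qed.

Definition index_weight (N : nat) (bar : bool) (k i : nat) : K :=
  if bar then (br q (N - i))^-1 else q ^+ i * br q i ^- k.

Lemma zeta_sum_cons M N r (A : {set 'I_r.+1}) (k : 'I_r.+1 -> nat) :
  zeta_sum q M N A k = \sum_(i < N | (M < i)%N)
    index_weight N (ord0 \in A) (k ord0) i *
    zeta_sum q (if ord0 \in A then i.-1 else i) N (tail_set A)
      (fun j => k (lift ord0 j)).
Proof.
rewrite /zeta_sum.
pose cons_ffun (i : 'I_N) (n : {ffun 'I_r -> 'I_N}) : {ffun 'I_r.+1 -> 'I_N} :=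
  [ffun j => if unlift ord0 j is Some j' then n j' else i].
have cons0 i n : cons_ffun i n ord0 = i by rewrite ffunE unlift_none.
have consS i n j : cons_ffun i n (lift ord0 j) = n j by rewrite ffunE liftK.
have consK i n : [ffun j => cons_ffun i n (lift ord0 j)] = n.
  by apply/ffunP => j; rewrite ffunE consS.
rewrite (reindex (fun p => cons_ffun p.1 p.2)) /=; last first.
  exists (fun n => (n ord0, [ffun j => n (lift ord0 j)])) => [[i n]|n] _ /=.
    by rewrite cons0 consK.
  apply/ffunP=> j; case: (unliftP ord0 j) => [j'|] ->.
    by rewrite consS ffunE.
  by rewrite cons0.
under eq_bigl => p do rewrite admissible_cons cons0 consK.
rewrite -(pair_big_dep (fun i : 'I_N => (M < i)%N)
  (fun i n => admissible (if ord0 \in A then i.-1 else val i) (tail_set A) n)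
  (fun i n => (\prod_(j in A) (br q (N - cons_ffun i n j))^-1) *
    \prod_(j in ~: A)
      (q ^+ cons_ffun i n j * br q (cons_ffun i n j) ^- k j))) /=.
apply: eq_bigr => i _; rewrite mulr_sumr; apply: eq_bigr => n _.
rewrite !(big_mkcond (fun j => j \in _)) !big_ord_recl /= !cons0.
rewrite !inE /index_weight.
transitivity (
  (if ord0 \in A then (br q (N - i))^-1 else q ^+ i * br q i ^- k ord0) *
  ((\prod_(j < r) if lift ord0 j \in A then (br q (N - n j))^-1 else 1) *
   (\prod_(j < r) if lift ord0 j \notin A
                   then q ^+ n j * br q (n j) ^- k (lift ord0 j) else 1))).
  rewrite mulrACA; congr (_ * (_ * _)).
  - by case: ifP => _ /=; rewrite ?mul1r ?mulr1.
  - by apply: eq_bigr => j _; rewrite consS.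
  - by apply: eq_bigr => j _; rewrite !inE consS.
congr (_ * (_ * _)); rewrite [RHS]big_mkcond; apply: eq_bigr => j _.
all: by rewrite !inE.
Qed.

Lemma zeta_sum0 M N (A : {set 'I_0}) k : zeta_sum q M N A k = 1.
Proof.
rewrite /zeta_sum (big_pred1 (ffun0 (card_ord 0))) => [|n].
  by rewrite !big1 ?mulr1 // => -[].
rewrite -[RHS]/(n == ffun0 _); have -> : n = ffun0 (card_ord 0).
  by apply/ffunP => -[].
by rewrite eqxx; apply/andP; split; apply/forallP => -[].
Qed.

Lemma zeta_dag_nil M N : zeta_dag q M N [::] = 1.
Proof. exact: zeta_sum0. Qed.

Lemma zeta_dag_cons M N x s : zeta_dag q M N (x :: s) =
  \sum_(i < N | (M < i)%N) index_weight N (is_bar x) (int_part x) i *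
    zeta_dag q (if is_bar x then i.-1 else i) N s.
Proof.
rewrite /zeta_dag /= zeta_sum_cons !inE /=; apply: eq_bigr => i _.
by congr (_ * zeta_sum _ _ _ _ _); apply/setP => j; rewrite !inE.
Qed.

Lemma zeta_diamond_nil M N : zeta_diamond q M N [::] = 1.
Proof.
rewrite /zeta_diamond (big_pred1 set0) => [|A]; first exact: zeta_sum0.
have -> : A = set0 by apply/setP => -[].
by rewrite /= eqxx sub0set.
Qed.

(** The sets A are split by membership of position 0, which is allowed only for k = 1; hence the
    indicator on the second summand. *)
Lemma zeta_diamond_cons M N k s : zeta_diamond q M N (k :: s) =
  \sum_(i < N | (M < i)%N)
    (index_weight N false k i * zeta_diamond q i N s
     + (k == 1%N)%:R * (index_weight N true k i * zeta_diamond q i.-1 N s)).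
Proof.
rewrite /zeta_diamond big_mkcond [LHS]big_cons_set big_split /=.
have sub b (A : {set 'I_(size s)}) :
    (cons_set b A \subset [set i : 'I_(size s).+1 | (k :: s)`_i == 1%N]) =
    (b ==> (k == 1%N)) && (A \subset [set i : 'I_(size s) | s`_i == 1%N]).
  apply/subsetP/andP => [H|[/implyP b1 /subsetP H] i].
    split.
      by apply/implyP => bT; have := H ord0; rewrite in_cons_set0 !inE; apply.
    apply/subsetP => j jA; have := H (lift ord0 j).
    by rewrite in_cons_setS !inE; apply.
  case: (unliftP ord0 i) => [j|] ->.
    by rewrite in_cons_setS => /H; rewrite !inE.
  by rewrite in_cons_set0 !inE.
congr (_ + _).
- under eq_bigr => A _ do rewrite sub /= zeta_sum_cons in_cons_set0 cons_setK.
  rewrite -big_mkcond exchange_big /=; apply: eq_bigr => i _.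
  by rewrite mulr_sumr.
- under eq_bigr => A _ do rewrite sub /= zeta_sum_cons in_cons_set0 cons_setK.
  rewrite -big_mkcond; case: (k == 1%N) => /=.
    rewrite exchange_big /=; apply: eq_bigr => i _.
    by rewrite mul1r mulr_sumr.
  by rewrite big_pred0 // big1 // => i _; rewrite mul0r.
Qed.

End Peel.

(** * Recursion in M for xi and for the generating series G *)

Section XiRecursion.
Variables (K : fieldType) (q : K) (eps : bool) (N : nat).

Lemma big_gt_recl M (f : nat -> K) : (M.+1 < N)%N ->
  \sum_(i < N | (M < i)%N) f i = f M.+1 + \sum_(i < N | (M.+1 < i)%N) f i.
Proof.
move=> MN; rewrite (bigD1 (Ordinal MN)) //=; congr (_ + _).
by apply: eq_bigl => i; rewrite -val_eqE /= [RHS]ltn_neqAle eq_sym andbC.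
Qed.

Lemma xi_nil M : xi q eps M N [::] = 1.
Proof. by rewrite /xi; case: eps; rewrite ?zeta_diamond_nil ?zeta_dag_nil. Qed.

Lemma xi_out M l k s : (N <= M.+1)%N -> xi q eps M N [:: l, k & s] = 0.
Proof.
move=> NM; have out (i : 'I_N) : (M < i)%N = false by have := ltn_ord i; lia.
by rewrite /xi; case: eps => /=; case: l.-1 => [|m] /=;
  rewrite ?zeta_diamond_cons ?zeta_dag_cons big_pred0.
Qed.

(** Only n_1 = M + 1 is split off. A non-strict step from it leaves the lower bound (M + 1) - 1 = M,
    so the middle term stays at M; the last term is the strict choice, available for eps = 1
    only. *)
Lemma xi_recl M l k s : (M.+1 < N)%N ->
  xi q eps M N [:: l.+2, k & s] = xi q eps M.+1 N [:: l.+2, k & s]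
    + (br q (N - M.+1))^-1 * xi q eps M N [:: l.+1, k & s]
    + (eps%:R * q ^+ M.+1 / br q M.+1) * xi q eps M.+1 N [:: l.+1, k & s].
Proof.
move=> MN; rewrite /xi; case: eps => /=.
- set t := _ ++ _; rewrite 2!(zeta_diamond_cons _ _ _ 1%N).
  apply: etrans (big_gt_recl (fun i => index_weight q N false 1 i *
    zeta_diamond q i N t + (1 == 1%N)%:R * (index_weight q N true 1 i *
    zeta_diamond q i.-1 N t)) MN) _.
  by rewrite /index_weight /= expr1; ring.
- set t := _ ++ _; rewrite 2!(zeta_dag_cons _ _ _ Bar1).
  apply: etrans (big_gt_recl (fun i => index_weight q N true 0 i *
    zeta_dag q i.-1 N t) MN) _.
  by rewrite /index_weight /=; ring.
Qed.

(** The first entry is k + 1 for eps = 0 and k + 2 for eps = 1, so it is neither bar 1 nor, in the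
    diamond sum, 1: only a strict step can follow it. *)
Lemma xi_recl0 M k s : (M.+1 < N)%N ->
  xi q eps M N [:: 1%N, k.+1 & s] = xi q eps M.+1 N [:: 1%N, k.+1 & s]
    + q ^+ M.+1 * br q M.+1 ^- (k.+1 + eps) * xi q eps M.+1 N s.
Proof.
move=> MN; rewrite /xi; case: eps => /=.
- rewrite 2!zeta_diamond_cons.
  apply: etrans (big_gt_recl (fun i => index_weight q N false k.+2 i *
    zeta_diamond q i N (args1 s) + (k.+2 == 1%N)%:R * (index_weight q N true
    k.+2 i * zeta_diamond q i.-1 N (args1 s))) MN) _.
  by rewrite /index_weight /= addn1; ring.
- rewrite 2!zeta_dag_cons.
  apply: etrans (big_gt_recl (fun i => index_weight q N false k.+1 i *
    zeta_dag q i N (args0 s)) MN) _.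
  by rewrite /index_weight /= addn0; ring.
Qed.

Lemma G_nil n M : G q eps M N [::] = 1 :> fps n K.
Proof. by rewrite /G fps_eval_nil xi_nil scale1r. Qed.

Lemma G_out n M (Y X : fps n K) W : (N <= M.+1)%N ->
  G q eps M N [:: Y, X & W] = 0.
Proof.
(* Zero is written [0 * 0] so that [fps_evalZ] extracts the scalar 0. *)
move=> NM; transitivity (fps_eval (fun=> 0 * 0) [:: Y, X & W] : fps n K).
  by apply: eq_fps_eval => -[|l [|k s]] //= _; rewrite mul0r xi_out.
by rewrite (fps_evalZ 0 (fun=> 0)) scale0r.
Qed.

(** J collects the terms with n_1 = M + 1 in which the exponent of Y is 0. It is a geometric series
    in X times a series in W, described here without denominators. *)
Lemma G_rec n M (Y X : fps n K) W : (M.+1 < N)%N ->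
  (forall v, v \in [:: Y, X & W] -> order_ge 1 v) ->
  exists2 J : fps n K,
    (1 - (br q (N - M.+1))^-1 *: Y) * G q eps M N [:: Y, X & W] =
    (1 + (eps%:R * q ^+ M.+1 / br q M.+1) *: Y) *
      G q eps M.+1 N [:: Y, X & W] + J
  & (1 - (br q M.+1)^-1 *: X) * J =
    (q ^+ M.+1 * br q M.+1 ^- (1 + eps)) *: G q eps M.+1 N W.
Proof.
move=> MN W1; have W1' v : v \in X :: W -> order_ge 1 v.
  by move=> vW; apply: W1; rewrite inE vW orbT.
pose J := fps_eval (fun e => (q ^+ M.+1 * br q M.+1 ^- ((head 0 e).+1 + eps)) *
  xi q eps M.+1 N [seq x.+1 | x <- behead e]) (X :: W).
exists J.
- rewrite /G.
  have E m := fps_eval_cons (fun e => xi q eps m N [seq x.+1 | x <- e]) W1.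
  rewrite !mulrBl !mulrDl !mul1r -!scalerAl.
  rewrite [X in X - _]E [X in _ = X + _ + _]E.
  rewrite (@eq_fps_eval _ _ _ (fun e =>
      xi q eps M.+1 N [seq x.+1 | x <- 0%N :: e]
      + (q ^+ M.+1 * br q M.+1 ^- ((head 0 e).+1 + eps)) *
        xi q eps M.+1 N [seq x.+1 | x <- behead e]) (X :: W)); last first.
    by case=> [|k s] //= _; rewrite xi_recl0.
  rewrite fps_evalD -/J.
  rewrite (@eq_fps_eval _ _
      (fun e => xi q eps M N [seq x.+1 | x <- (head 0%N e).+1 :: behead e])
      (fun e =>
        xi q eps M.+1 N [seq x.+1 | x <- (head 0%N e).+1 :: behead e]
        + (br q (N - M.+1))^-1 * xi q eps M N [seq x.+1 | x <- e]
        + (eps%:R * q ^+ M.+1 / br q M.+1) *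
          xi q eps M.+1 N [seq x.+1 | x <- e]) [:: Y, X & W]); last first.
    by case=> [|l [|k s]] //= _; rewrite xi_recl.
  rewrite 2!fps_evalD 2!fps_evalZ !mulrDr -!scalerAr; by ring.
- rewrite mulrBl mul1r -scalerAl {1}/J fps_eval_cons //.
  set T := fps_eval _ W; set T' := fps_eval _ (X :: W).
  (* Raising the exponent of X by one divides the coefficient by [br q M.+1]. *)
  have -> : T' = (br q M.+1)^-1 *: J.
    rewrite -fps_evalZ; apply: eq_fps_eval => -[|k s] //= _.
    by rewrite addSn exprS invfM; ring.
  rewrite -scalerAr addrK /G -fps_evalZ; apply: eq_fps_eval => e _ /=.
  by rewrite add1n.
Qed.

End XiRecursion.

(** * The recursion for G in rational form, and the expansion over deletions *)

Section Domain.
Variables (F : fieldType) (eps : bool).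
Implicit Types (u c x y : F).

Definition a_factor u c y := (u - c) / (u * y - c).
Definition b_factor u y := ((1 - u * y) / (1 - u)) ^+ eps.
Definition w_factor u x := u / ((1 - u) ^+ eps * (x - u)).

(** The parameter d stands for q^(N-M-1), so that u * d = q^N. *)
Lemma G_rec_solve u d Y X g g1 g2 J : u != 0 -> u != 1 -> d != 1 ->
  u * (1 - Y) != u * d -> 1 - X != u ->
  (1 - (1 - d)^-1 * Y) * g = (1 + (eps%:R * u / (1 - u)) * Y) * g1 + J ->
  (1 - (1 - u)^-1 * X) * J = (u * (1 - u) ^- (1 + eps)) * g2 ->
  g = a_factor u (u * d) (1 - Y) *
    (b_factor u (1 - Y) * g1 + w_factor u (1 - X) * g2).
Proof.
move=> u0 u1 d1 hY hX eg eJ.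
have u1' : 1 - u != 0 by rewrite subr_eq0 eq_sym.
have d1' : 1 - d != 0 by rewrite subr_eq0 eq_sym.
have hY' : 1 - d - Y != 0.
  apply: contra_neq hY => e; congr (u * _).
  by apply/eqP; rewrite -subr_eq0 addrAC e.
have hX' : 1 - X - u != 0 by rewrite subr_eq0.
have hY2 : u * (1 - Y) - u * d != 0 by rewrite subr_eq0.
have -> : g = (1 - d) / (1 - d - Y) *
    ((1 + (eps%:R * u / (1 - u)) * Y) * g1 + J).
  by rewrite -eg; field; rewrite hY' d1'.
have -> : J = (1 - u) / (1 - X - u) * ((u * (1 - u) ^- (1 + eps)) * g2).
  by rewrite -eJ; field; rewrite hX' u1'.
rewrite /a_factor /b_factor /w_factor; case: eps => /=; field.
all: by rewrite ?hY' ?hX' ?hY2 ?u1' ?d1' ?u0.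
Qed.

End Domain.

(* States of a scan of the variables from left to right: AfterOE when the
   preceding pair Y_(j-1), X_(j-1) has been deleted as an OE block, InEO when
   X_(j-1) has been deleted as the first half of an EO pair. *)
Inductive scan_state := Free | AfterOE | InEO.

(** The variables kept so far are stored in f as a prefix. A scan ending in [InEO] gives 0, because
    the deleted X_r would need a partner Y_(r+1). *)
Fixpoint expand (F : pzRingType) (V : Type) (C : F) (st : scan_state)
    (f : seq V -> F) (W : seq V) : F :=
  match W with
  | [:: Y, X & W'] =>
    match st with
    | Free => expand C Free (fun U => f [:: Y, X & U]) W'
        - C * expand C InEO (fun U => f (Y :: U)) W' + C * expand C AfterOE f W'
    | AfterOE => expand C Free (fun U => f [:: Y, X & U]) W'
        - C * expand C InEO (fun U => f (Y :: U)) W'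
    | InEO => expand C Free (fun U => f (X :: U)) W' - C * expand C InEO f W'
    end
  | _ => if st is InEO then 0 else f [::]
  end.

Lemma seq2_ind (V : Type) (P : seq V -> Prop) :
  P [::] -> (forall Y, P [:: Y]) -> (forall Y X W, P W -> P [:: Y, X & W]) ->
  forall W, P W.
Proof.
move=> P0 P1 P2 W; suff [] : P W /\ forall Y, P (Y :: W) by [].
by elim: W => [|X W [IH1 IH2]]; split => // Y; apply: P2.
Qed.

Section ExpandTheory.
Variables (F : comPzRingType) (V : Type) (C : F).
Implicit Types (f g : seq V -> F).

Lemma expand_linear st a b f g W :
  expand C st (fun U => a * f U + b * g U) W =
  a * expand C st f W + b * expand C st g W.
Proof.
elim/seq2_ind: W st f g => [|Y|Y X W IH] [] f g //=; rewrite ?mulr0 ?addr0 //;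
  rewrite !IH; ring.
Qed.

Lemma eq_expand st f g W : f =1 g -> expand C st f W = expand C st g W.
Proof.
by move=> /funext ->.
Qed.

(* Both of the last two terms contain C ^+ 2 times the expansion of W, with all
   of Y, X, Y', X' deleted; these contributions cancel. *)
Lemma expand_step f Y X Y' X' W :
  expand C Free f [:: Y, X, Y', X' & W] =
    expand C Free (fun U => f [:: Y, X & U]) [:: Y', X' & W]
    + C * expand C Free f [:: Y', X' & W]
    - C * expand C Free f [:: Y, X' & W].
Proof. by rewrite /=; ring. Qed.

End ExpandTheory.

Lemma factor_exchange (F : fieldType) (eps : bool) (u c x y y' : F) :
  u != 1 -> c != 1 -> x != u -> u * y != c -> u * y' != c ->
  (x * y' - c) * w_factor eps u x * a_factor u c y' =
  a_factor u c y * (x * y - c) * w_factor eps u x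
  + c / (1 - c) ^+ eps *
    (a_factor u c y' * b_factor eps u y' - a_factor u c y * b_factor eps u y).
Proof.
rewrite ![_ == 1]eq_sym => hu hc hx hy hy'.
rewrite -subr_eq0 in hu; rewrite -subr_eq0 in hc; rewrite -subr_eq0 in hx.
rewrite -subr_eq0 in hy; rewrite -subr_eq0 in hy'.
rewrite /a_factor /b_factor /w_factor.
by case: eps; field; rewrite ?oner_neq0 ?hu ?hc ?hx ?hy ?hy'.
Qed.

(** * Descending induction on M for the two sides *)

Section Transport.
Variables (F : fieldType) (V : Type) (z : V -> F) (q : F).
Variables (N : nat) (eps : bool).
Let c := q ^+ N.
Let C := c / (1 - c) ^+ eps.
Let a := fun n => a_factor (q ^+ n) c.
Let b := fun n => b_factor eps (q ^+ n).
Let w := fun n => w_factor eps (q ^+ n).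

Hypothesis q_neq0 : q != 0.
Hypothesis q_expn_neq1 : forall n, (0 < n)%N -> q ^+ n != 1.
Hypothesis z_neq : forall v n, z v != q ^+ n.
Hypothesis z_neqN : forall v n, q ^+ n * z v != c.

(** These stand for G_N and G_(N+1) as functions of M and the variables; z sends a variable to its
    power of q, such as q^Y = 1 - <Y>. *)
Variables g h : nat -> seq V -> F.
Hypothesis g_nil : forall n, g n [::] = 1.
Hypothesis h_nil : forall n, h n [::] = 1.
Hypothesis g_out : forall n Y X W, (N <= n.+1)%N -> g n [:: Y, X & W] = 0.
Hypothesis h_out : forall n Y X W, (N <= n)%N -> h n [:: Y, X & W] = 0.
Hypothesis g_rec : forall n Y X W, (n.+1 < N)%N ->
  g n [:: Y, X & W] = a n.+1 (z Y) *
    (b n.+1 (z Y) * g n.+1 [:: Y, X & W] + w n.+1 (z X) * g n.+1 W).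
Hypothesis h_rec : forall n Y X W, (n < N)%N ->
  h n [:: Y, X & W] = a n (z Y) *
    (b n.+1 (z Y) * h n.+1 [:: Y, X & W] + w n.+1 (z X) * h n.+1 W).

(** The default 1 is q^0, from the convention Y_(r+1) = 0. *)
Definition head_val (W : seq V) : F := if W is Y :: _ then z Y else 1.

(** Since <N> - <Z + W> = q^Z q^W - q^N, these are the factors for X_i, Y_(i+1) with i at least
    1. *)
Fixpoint shifted_prod (W : seq V) : F :=
  if W is [:: Y, X & W'] then (z X * head_val W' - c) * shifted_prod W' else 1.

Fixpoint paired_prod (W : seq V) : F :=
  if W is [:: Y, X & W'] then (z X * z Y - c) * paired_prod W' else 1.

(** The left-hand side of the theorem at M = n: dividing by [a] supplies the factor for i = 0 over
    <N> - <M>. *)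
Definition shifted n W := shifted_prod W * h n W / a n (head_val W).
Definition paired n W := paired_prod W * g n W.

Lemma qn_neq n : (n < N)%N -> q ^+ n != c.
Proof.
move=> nN; rewrite /c -(subnKC (ltnW nN)) exprD -subr_eq0 -{1}[q ^+ n]mulr1.
rewrite -mulrBr mulf_neq0 ?expf_neq0 // subr_eq0 eq_sym q_expn_neq1 //.
by rewrite subn_gt0.
Qed.

Lemma head_val_neq n W : (n < N)%N -> q ^+ n * head_val W - c != 0.
Proof.
by move=> nN; rewrite subr_eq0; case: W => [|Y W] //=; rewrite mulr1 qn_neq.
Qed.

Lemma a_neq0 n W : (n < N)%N -> a n (head_val W) != 0.
Proof.
move=> nN; rewrite /a /a_factor mulf_neq0 ?invr_eq0 ?head_val_neq //.
by rewrite subr_eq0 qn_neq.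
Qed.

Lemma shifted_nil n : (n < N)%N -> shifted n [::] = 1.
Proof.
move=> nN; rewrite /shifted h_nil /a /a_factor /= !mulr1 mul1r divff ?invr1 //.
by rewrite subr_eq0 qn_neq.
Qed.

Lemma paired_nil n : paired n [::] = 1.
Proof. by rewrite /paired g_nil mulr1. Qed.

Lemma shifted_rec n Y X W : (n.+1 < N)%N ->
  shifted n [:: Y, X & W] =
    a n.+1 (z Y) * b n.+1 (z Y) * shifted n.+1 [:: Y, X & W]
    + (z X * head_val W - c) * w n.+1 (z X) * a n.+1 (head_val W) *
      shifted n.+1 W.
Proof.
move=> nN; rewrite /shifted h_rec ?(ltnW nN) //=.
have h1 := a_neq0 [:: Y] (ltnW nN); have h2 := a_neq0 [:: Y] nN.
have h3 := a_neq0 W nN; rewrite /= in h1 h2.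
by field; rewrite h1 h2 h3.
Qed.

(** The first term of the recursion vanishes by [h_out], and Y drops out as its [a] cancels. A
    single pair leaves C, the weight of a deleted OE block. *)
Lemma shifted_last n Y X W : n.+1 = N ->
  shifted n [:: Y, X & W] = if W is [::] then C else
    (z X * head_val W - c) * shifted_prod W * w N (z X) * h N W.
Proof.
move=> nN; have nN' : (n < N)%N by rewrite nN.
have h1 := a_neq0 [:: Y] nN'; rewrite /= in h1.
have -> : shifted n [:: Y, X & W] =
    (z X * head_val W - c) * shifted_prod W * w N (z X) * h N W.
  rewrite /shifted h_rec //= (@h_out n.+1) ?nN //.
  by field.
case: W => //; rewrite /= h_nil !mulr1 /w /w_factor -/c /C.
have h2 : z X - c != 0 by rewrite subr_eq0 z_neq.
have [N0|Np] := posnP N; first by rewrite N0 in nN.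
have h3 : 1 - c != 0 by rewrite subr_eq0 eq_sym q_expn_neq1.
by field; rewrite h2 expf_neq0.
Qed.

Lemma paired_rec n Y X W : (n.+1 < N)%N ->
  paired n [:: Y, X & W] =
    a n.+1 (z Y) * b n.+1 (z Y) * paired n.+1 [:: Y, X & W]
    + a n.+1 (z Y) * (z X * z Y - c) * w n.+1 (z X) * paired n.+1 W.
Proof. by move=> nN; rewrite /paired g_rec //=; ring. Qed.

Lemma expand_paired_rec n Y X W : (n.+1 < N)%N ->
  expand C Free (fun U => paired n [:: Y, X & U]) W =
    a n.+1 (z Y) * b n.+1 (z Y) *
      expand C Free (fun U => paired n.+1 [:: Y, X & U]) W
    + a n.+1 (z Y) * (z X * z Y - c) * w n.+1 (z X) *
      expand C Free (paired n.+1) W.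
Proof.
by move=> nN; rewrite -expand_linear; apply: eq_expand => U; apply: paired_rec.
Qed.

Lemma expand_paired_last n Y X W : n.+1 = N ->
  expand C Free (fun U => paired n [:: Y, X & U]) W = 0.
Proof.
move=> nN; rewrite (@eq_expand _ _ _ _ _ (fun U => 0 * 0 + 0 * 0)).
  by rewrite (expand_linear _ _ _ _ (fun=> 0) (fun=> 0)) !mul0r addr0.
by move=> U; rewrite /paired g_out ?nN // !mulr0 addr0.
Qed.

Lemma nat_down_ind (P : nat -> Prop) : (forall n, n.+1 = N -> P n) ->
  (forall n, (n.+1 < N)%N -> P n.+1 -> P n) -> forall n, (n < N)%N -> P n.
Proof.
move=> P0 PS n nN.
have [k e] : exists k, (n + k).+1 = N by exists (N - n.+1)%N; lia.
elim: k n e {nN} => [|k IH] n e; first by apply: P0; rewrite -e addn0.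
by apply: PS; [lia | apply: IH; lia].
Qed.

Theorem shifted_expand W : ~~ odd (size W) -> forall n, (n < N)%N ->
  shifted n W = expand C Free (paired n) W.
Proof.
have [m] := ubnP (size W); elim: m W => // m IH [|Y [|X [|Y' [|X' W]]]] //= sW.
- by move=> _ n nN; rewrite shifted_nil // paired_nil.
- move=> _; apply: nat_down_ind => [n nN|n nN IHn].
    rewrite shifted_last // paired_nil.
    have := expand_paired_last Y X [::] nN; rewrite /= => ->.
    by rewrite mulr0 subr0 mulr1 add0r.
  rewrite shifted_rec // IHn shifted_nil //= (paired_rec _ _ _ nN) !paired_nil.
  have c1 : c != 1 by rewrite q_expn_neq1 // (leq_trans _ nN).
  (* A single pair is the exchange identity with y' = 1, where [a] and [b] take the value 1. *)
  have := @factor_exchange F eps (q ^+ n.+1) c (z X) (z Y) 1.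
  rewrite z_neq z_neqN c1 q_expn_neq1 // mulr1 qn_neq //.
  have : a n.+1 1 * b n.+1 1 = 1.
    rewrite /a /b /a_factor /b_factor !mulr1 !divff ?expr1n ?mulr1 //.
      by rewrite subr_eq0 eq_sym q_expn_neq1.
    by rewrite subr_eq0 qn_neq.
  rewrite /a /b /w => e /(_ isT isT isT isT isT); rewrite mulr1 e => ->.
  by rewrite /C; ring.
rewrite !negbK => oW.
have {}IH v : forall n, (n < N)%N ->
    shifted n [:: v, X' & W] = expand C Free (paired n) [:: v, X' & W].
  by apply: IH; rewrite /= ?negbK //; lia.
(* The two shorter sequences are kept as [shifted], so that their own recursion in n applies; the
   induction on length converts them to [expand]. *)
suff H n : (n < N)%N -> shifted n [:: Y, X, Y', X' & W] =
  expand C Free (fun U => paired n [:: Y, X & U]) [:: Y', X' & W]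
   + C * shifted n [:: Y', X' & W] - C * shifted n [:: Y, X' & W].
  by move=> n nN; rewrite H // !IH // -expand_step.
move: n; apply: nat_down_ind => [n nN|n nN IHn].
  (* At n = N - 1 the values of the two shorter sequences do not depend on Y' or Y, so they cancel;
     the other terms vanish. *)
  rewrite expand_paired_last // !shifted_last // h_out //.
  by case: W {IH sW oW} => [|? ?]; ring.
rewrite expand_paired_rec // [LHS]shifted_rec // IHn -IH //.
(* The second summands of these two recursions involve neither Y' nor Y and cancel; the rest is the
   exchange identity. *)
rewrite [shifted n [:: Y', _ & _]]shifted_rec //.
rewrite [shifted n [:: Y, _ & _]]shifted_rec //=.
have c1 : c != 1 by rewrite q_expn_neq1 // (leq_trans _ nN).
have := @factor_exchange F eps (q ^+ n.+1) c (z X) (z Y) (z Y').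
rewrite z_neq !z_neqN c1 q_expn_neq1 // /a /b /w => /(_ isT isT isT isT isT) ->.
by rewrite /C; ring.
Qed.

End Transport.

(** * The expansion as a sum over bit sequences, [true] marking a deletion *)

Section Bits.
Variables (R : comPzRingType) (C : R).

Fixpoint bits_sum (n : nat) (f : bitseq -> R) : R :=
  if n is n'.+1 then
    bits_sum n' (fun b => f (false :: b)) + bits_sum n' (fun b => f (true :: b))
  else f [::].

Lemma bits_sumZ n a f : bits_sum n (fun b => a * f b) = a * bits_sum n f.
Proof. by elim: n f => //= n IH f; rewrite !IH mulrDr. Qed.

Lemma eq_bits_sum n f g : f =1 g -> bits_sum n f = bits_sum n g.
Proof. by move=> /funext ->. Qed.

Definition bits n (T : {set 'I_n}) : bitseq := [seq i \in T | i <- enum 'I_n].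

Lemma bits_cons n b (T : {set 'I_n}) : bits (cons_set b T) = b :: bits T.
Proof.
rewrite /bits enum_ordSl /= in_cons_set0 -map_comp; congr (_ :: _).
by apply: eq_map => i; rewrite /= in_cons_setS.
Qed.

Lemma sum_bits n f : \sum_(T : {set 'I_n}) f (bits T) = bits_sum n f.
Proof.
elim: n f => [|n IH] f /=.
  rewrite (big_pred1 set0) => [|T]; last by apply/esym/eqP/setP => -[].
  by rewrite /bits enum_ord0.
rewrite big_cons_set -!IH; congr (_ + _); apply: eq_bigr => T _;
  by rewrite bits_cons.
Qed.

Fixpoint weight (st : scan_state) (b : bitseq) : R :=
  match b, st with
  | [:: false, false & b'], (Free | AfterOE) => weight Free b'
  | [:: false, true & b'], (Free | AfterOE) => - C * weight InEO b'
  | [:: true, true & b'], Free => C * weight AfterOE b'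
  | [:: true, false & b'], InEO => weight Free b'
  | [:: true, true & b'], InEO => - C * weight InEO b'
  | [::], (Free | AfterOE) => 1
  | _, _ => 0
  end.

Lemma expand_bits (V : Type) st (f : seq V -> R) W : ~~ odd (size W) ->
  expand C st f W =
  bits_sum (size W) (fun b => weight st b * f (mask (map negb b) W)).
Proof.
elim/seq2_ind: W st f => [|Y|Y X W IH] st f //=.
  by case: st; rewrite ?mul1r ?mul0r.
rewrite negbK => oW.
have E a st' g : bits_sum (size W) (fun b => a * weight st' b *
    g (mask (map negb b) W)) = a * expand C st' g W.
  by rewrite IH // -bits_sumZ; apply: eq_bits_sum => b; rewrite mulrA.
have E0 g : bits_sum (size W) (fun b => 0 * g b) = 0 by rewrite bits_sumZ mul0r.
have E1 st' g : bits_sum (size W) (fun b => weight st' b *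
    g (mask (map negb b) W)) = expand C st' g W by rewrite IH.
case: st => /=.
- rewrite (E (- C) InEO (fun U => f (Y :: U))) (E C AfterOE f).
  by rewrite (E1 Free (fun U => f [:: Y, X & U])) !E0; ring.
- rewrite (E (- C) InEO (fun U => f (Y :: U))) !E0.
  by rewrite (E1 Free (fun U => f [:: Y, X & U])); ring.
- by rewrite (E (- C) InEO f) !E0 (E1 Free (fun U => f (X :: U))); ring.
Qed.

Fixpoint accepts (st : scan_state) (b : bitseq) : bool :=
  match b, st with
  | [:: false, false & b'], (Free | AfterOE) => accepts Free b'
  | [:: false, true & b'], (Free | AfterOE) => accepts InEO b'
  | [:: true, true & b'], Free => accepts AfterOE b'
  | [:: true, false & b'], InEO => accepts Free b'
  | [:: true, true & b'], InEO => accepts InEO b'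
  | [::], (Free | AfterOE) => true
  | _, _ => false
  end.

Fixpoint eo_bits (p : bool) (b : bitseq) : nat :=
  if b is [:: y, x & b'] then ((p && y) + eo_bits x b')%N else 0%N.

(** The factor -C in the last clause belongs to the EO pair whose first half was deleted just before
    b; hence the extra 1 in the count and the flag [true], which records that deletion for the
    sign. *)
Lemma weightE b :
  [/\ weight Free b = if accepts Free b then
        (-1) ^+ eo_bits false b * C ^+ (count id b)./2 else 0,
      weight AfterOE b = if accepts AfterOE b then
        (-1) ^+ eo_bits true b * C ^+ (count id b)./2 else 0
    & - C * weight InEO b = if accepts InEO b then
        (-1) ^+ eo_bits true b * C ^+ (count id b).+1./2 else 0].
Proof.
elim/seq2_ind: b => [|[]|y x b [IH1 IH2 IH3]] /=;
  rewrite ?expr0 ?mulr0 ?mulr1 //.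
case: y; case: x; rewrite /= ?add0n ?add1n ?addn1 ?mulr0; split=> //=.
- by rewrite IH2; case: ifP => _; rewrite ?mulr0 // exprS; ring.
- by rewrite IH3; case: ifP => _; rewrite ?mulr0 // !exprS; ring.
- by rewrite IH1; case: ifP => _; rewrite ?mulr0 // !exprS; ring.
Qed.

End Bits.

(** * Labels 1, ..., 2r, and acceptance of a scan as a local condition *)

Section Labels.

(** Being false at 0 and beyond n, this makes conditions on neighbouring labels uniform at both
    ends. *)
Definition label n (T : {set 'I_n}) (i : nat) : bool :=
  [exists k in T, k.+1 == i :> nat].

Lemma label_succ n (T : {set 'I_n}) (k : 'I_n) : label T k.+1 = (k \in T).
Proof.
apply/existsP/idP => [[k' /andP[kT /eqP[/val_inj <-]]] //|kT].
by exists k; rewrite kT eqxx.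
Qed.

Lemma labelP n (T : {set 'I_n}) i :
  reflect (exists2 k : 'I_n, k \in T & i = k.+1) (label T i).
Proof.
apply: (iffP existsP) => [[k /andP[kT /eqP <-]]|[k kT ->]]; first by exists k.
by exists k; rewrite kT eqxx.
Qed.

Lemma label0 n (T : {set 'I_n}) : label T 0 = false.
Proof. by apply/labelP => -[]. Qed.

Lemma label_out n (T : {set 'I_n}) i : (n < i)%N -> label T i = false.
Proof. by move=> ni; apply/labelP => -[k _ e]; have := ltn_ord k; lia. Qed.

Lemma bits_label n (T : {set 'I_n}) : bits T = [seq label T i | i <- iota 1 n].
Proof.
rewrite -[1%N]addn0 iotaDl -val_enum_ord -2!map_comp; apply: eq_map => k /=.
by rewrite label_succ.
Qed.

Lemma card_bits n (T : {set 'I_n}) : count id (bits T) = #|T|.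
Proof.
by rewrite /bits count_map -sum1_count big_enum_cond -sum1_card; apply: eq_bigl.
Qed.

Lemma delete_bits r (V : Type) (W : 'I_(r.*2) -> V) (T : {set 'I_(r.*2)}) :
  delete W T = mask (map negb (bits T)) [seq W i | i <- enum 'I_(r.*2)].
Proof.
by rewrite /delete filter_mask -map_mask /bits -map_comp.
Qed.

(* j runs over the boundaries between the pairs (Y_j, X_j): an odd label deleted
   without its left neighbour starts an isolated OE block, and an even label
   deleted without its right neighbour ends one. *)
Definition boundary_ok (t : nat -> bool) (j : nat) : bool :=
  (t j.*2.+1 && ~~ t j.*2 ==> t j.*2.+2 && ~~ t j.*2.+3) &&
  (t j.*2 && ~~ t j.*2.+1 ==> t (j.*2).-1 && ~~ t (j.*2).-2).

(** The states correspond to what precedes label 2j + 1: label 2j kept, an isolated OE block ending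
    at 2j, or 2j deleted otherwise. Each step of the scan is then a finite case check on nearby
    labels. *)
Lemma accepts_boundary (t : nat -> bool) r k j :
  (forall i, (r.*2 < i)%N -> t i = false) -> (j + k)%N = r ->
  let b := [seq t i | i <- iota j.*2.+1 k.*2] in
  [/\ ~~ t j.*2 -> accepts Free b = all (boundary_ok t) (iota j k.+1),
      t j.*2 -> t (j.*2).-1 -> ~~ t (j.*2).-2 ->
        accepts AfterOE b = ~~ t j.*2.+1 && all (boundary_ok t) (iota j k.+1)
    & t j.*2 -> ~~ (t (j.*2).-1 && ~~ t (j.*2).-2) ->
        accepts InEO b = all (boundary_ok t) (iota j k.+1)].
Proof.
move=> t_out; elim: k j => [|k IH] j jk.
  have o1 : t j.*2.+1 = false by apply: t_out; rewrite -jk; lia.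
  rewrite /= /boundary_ok o1 /= !andbT.
  by split=> [/negPf->|-> -> /negPf->|-> /negPf->].
have [IH1 IH2 IH3] := IH j.+1 ltac:(lia); move: IH1 IH2 IH3.
rewrite doubleS [iota _ k.+2]/= [all _ (j :: _)]/=.
rewrite -[iota j.*2.+1 k.+1.*2]/[:: j.*2.+1, j.*2.+2 & iota j.*2.+3 k.*2] /=.
set A := boundary_ok t j.+1 && _; set bs := map _ _; rewrite {1}/boundary_ok.
rewrite /boundary_ok; clearbody A bs.
case: (t j.*2.+1); case: (t j.*2.+2); case: (t j.*2.+3); case: (t j.*2) => //=;
  case: (t (j.*2).-1); case: (t (j.*2).-2) => //= H1 H2 H3; split=> //= *;
  rewrite ?H1 ?H2 ?H3 //.
Qed.

End Labels.

(** * The family T(r) and the sum over it *)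

Section CalT.
Variable r : nat.
Implicit Types (S T : {set 'I_(r.*2)}).

Lemma label_lt T i : label T i -> (0 < i <= r.*2)%N.
Proof. by case/labelP => k _ ->; rewrite ltn_ord. Qed.

Lemma label_set (P : pred nat) i :
  label [set k : 'I_(r.*2) | P k.+1] i = (0 < i <= r.*2)%N && P i.
Proof.
apply/labelP/andP => [[k + ->]|[]]; first by rewrite inE ltn_ord.
by case: i => // i ir Pi; exists (Ordinal ir); rewrite ?inE.
Qed.

Lemma label_bigcup (I : finType) (R : {set I}) (s : I -> seq nat) i :
  label (\bigcup_(j in R) labels r (s j)) i =
  (0 < i <= r.*2)%N && [exists j in R, i \in s j].
Proof.
rewrite -(label_set (fun i => [exists j in R, i \in s j])).
congr (label _ i); apply/setP => k; rewrite inE.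
apply/bigcupP/existsP => [[j jR]|[j /andP[jR kj]]].
  by rewrite inE => kj; exists j; rewrite jR.
by exists j => //; rewrite inE.
Qed.

Lemma label_inj S T : (forall i, label S i = label T i) -> S = T.
Proof. by move=> ST; apply/setP => k; rewrite -!label_succ. Qed.

(** Here j is unrestricted: j = 0 and j = r exclude the labels 1 and 2r, which have no partner in an
    EO pair. *)
Lemma EOP S :
  reflect (forall j, label S j.*2 = label S j.*2.+1) (S \in EO r).
Proof.
apply: (iffP imsetP) => [[R + -> j]|HS].
  rewrite inE => /forallP R0; rewrite !label_bigcup.
  apply/andP/andP => -[_ /existsP[m /andP[mR]]];
    have := R0 m; have := ltn_ord m; rewrite mR !inE /= => mr m0 jm;
    (split; last (apply/existsP; exists m; rewrite mR !inE /=)); lia.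
have bound j : label S j.*2 -> (0 < j < r)%N.
  move=> Sj; have Sj' := Sj; rewrite HS in Sj'.
  by have := label_lt Sj; have := label_lt Sj'; lia.
exists [set j : 'I_r | label S j.*2].
  rewrite inE; apply/forallP => j; apply/implyP.
  by rewrite inE => /bound /andP[].
apply: label_inj => i; rewrite label_bigcup.
apply/idP/andP => [Si|[_ /existsP[j /andP[]]]]; last first.
  by rewrite !inE => Sj /orP[] /eqP ->; rewrite -?HS.
split; first exact: label_lt Si.
have Si2 : label S (i./2).*2.
  have := Si; rewrite -{1}(odd_double_half i).
  by case: (odd i); rewrite ?add1n ?add0n ?HS.
have /andP[_ lr] := bound _ Si2.
apply/existsP; exists (Ordinal lr); rewrite !inE /= Si2 /=.
by lia.
Qed.

Lemma OEP S :
  reflect (forall j, label S j.*2.+1 = label S j.*2.+2) (S \in OE r).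
Proof.
apply: (iffP imsetP) => [[R + -> j]|HS].
  rewrite inE => /forallP R0; rewrite !label_bigcup.
  apply/andP/andP => -[_ /existsP[m /andP[mR]]];
    have := R0 m; have := ltn_ord m; rewrite mR !inE /= => mr m0 jm;
    (split; last (apply/existsP; exists m; rewrite mR !inE /=)); lia.
have bound j : label S j.*2.+1 -> (j < r)%N.
  move=> Sj; have Sj' := Sj; rewrite HS in Sj'.
  by have := label_lt Sj'; lia.
exists [set j : 'I_r.+1 | (0 < j)%N && label S j.*2].
  by rewrite inE; apply/forallP => j; apply/implyP; rewrite inE => /andP[].
apply: label_inj => i; rewrite label_bigcup.
apply/idP/andP => [Si|[_ /existsP[[[|j] jr] /andP[]]]]; last first.
- by rewrite !inE /= => Sj /orP[] /eqP ->; rewrite ?HS.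
- by rewrite !inE.
split; first exact: label_lt Si.
have [j e] : exists j, (i == j.*2.+1) || (i == j.*2.+2).
  by exists (i.-1)./2; have := label_lt Si; lia.
have Sj : label S j.*2.+1 by case/orP: e => /eqP e; [|rewrite HS]; rewrite -e.
apply/existsP; exists (Ordinal (bound _ Sj : j.+1 < r.+1)%N).
by rewrite !inE /= -HS Sj.
Qed.

Lemma OEstarP S : S \in OEstar r ->
  (forall j, label S j.*2.+1 = label S j.*2.+2) /\
  (forall i, label S i -> ~~ label S i.+2).
Proof.
rewrite inE => /andP[/OEP HS /forallP H]; split=> // i.
case/labelP => k kS ->; apply/labelP => -[k' kS' [e]].
have /implyP/(_ kS)/forallP/(_ k')/implyP/(_ kS') := H k.
by rewrite -e eqxx.
Qed.

(** An OE block {2j-1, 2j} in S' is isolated: 2j + 1 is not in S', being at distance 2 from 2j - 1,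
    nor in S, which would then contain 2j; likewise for 2j - 2. Conversely, the deleted labels whose
    EO partner is deleted form S, the others S'. *)
Lemma calTP T :
  reflect (forall j, boundary_ok (label T) j) (T \in calT r).
Proof.
apply: (iffP imset2P) => [[S S' /EOP HS]|HT].
  rewrite inE => /andP[/OEstarP[HS' star] /eqP dis ->] j.
  have LU i : label (S :|: S') i = label S i || label S' i.
    case: (posnP i) => [->|]; first by rewrite !label0.
    case: i => // i _; have [ir|ir] := ltnP i r.*2; last by rewrite !label_out.
    by rewrite (label_succ _ (Ordinal ir)) inE -!(label_succ _ (Ordinal ir)).
  have LI i : label S i -> label S' i -> False.
    case/labelP => k kS -> ; rewrite label_succ => kS'.
    by have := in_set0 k; rewrite -dis inE kS kS'.
  apply/andP; split; apply/implyP;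
    rewrite !LU !negb_or => /andP[h1 /andP[h2 h3]].
    have s1 : label S' j.*2.+1 by move: h1; rewrite -HS (negPf h2).
    have s2 := s1; rewrite HS' in s2.
    have n2 : ~~ label S j.*2.+2 by apply/negP => /LI; apply.
    have n3 : ~~ label S j.*2.+3 by rewrite -doubleS -HS doubleS.
    by rewrite s2 orbT n3 star.
  have s1 : label S' j.*2 by move: h1; rewrite HS (negPf h2).
  case: j s1 {h1 h2 h3} => [|j]; first by rewrite label0.
  rewrite doubleS /= => s1; have s2 := s1; rewrite -HS' in s2.
  have n1 : ~~ label S j.*2.+1 by apply/negP => /LI; apply.
  rewrite s2 orbT HS n1 /=; apply/negP => /star.
  by rewrite s1.
(* The other label of the EO pair; for 1 and 2r it is 0 and 2r + 1, where [label T] is false. *)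
pose partner i := if odd i then i.-1 else i.+1.
pose S := [set k : 'I_(r.*2) | label T k.+1 && label T (partner k.+1)].
pose S' := [set k : 'I_(r.*2) | label T k.+1 && ~~ label T (partner k.+1)].
have LS i : label S i = label T i && label T (partner i).
  rewrite (label_set (fun i => label T i && label T (partner i))).
  by case: (boolP (label T i)) => [/label_lt->|]; rewrite // andbF.
have LS' i : label S' i = label T i && ~~ label T (partner i).
  rewrite (label_set (fun i => label T i && ~~ label T (partner i))).
  by case: (boolP (label T i)) => [/label_lt->|]; rewrite // andbF.
have pe j : partner j.*2 = j.*2.+1 by rewrite /partner odd_double.
have po j : partner j.*2.+1 = j.*2 by rewrite /partner /= odd_double.
have B j : label T j.*2.+1 && ~~ label T j.*2 =
    label T j.*2.+2 && ~~ label T j.*2.+3.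
  apply/idP/idP => e; first by have := HT j; rewrite /boundary_ok e => /andP[].
  by have := HT j.+1; rewrite /boundary_ok doubleS /= e => /andP[_].
exists S S'.
- by apply/EOP => j; rewrite !LS pe po andbC.
- rewrite inE; apply/andP; split; [rewrite inE; apply/andP; split|].
  + by apply/OEP => j; rewrite !LS' -doubleS pe po B.
  + apply/forallP => k; apply/implyP => kS; apply/forallP => k'.
    apply/implyP => kS'; apply/eqP => e; move: kS kS'.
    rewrite -!label_succ e; set i := k.+1; rewrite !LS'.
    have [j [] ->] : exists j, i = j.*2 \/ i = j.*2.+1.
      by exists i./2; lia.
    * rewrite -doubleS !pe doubleS -B => /andP[t1 _] /andP[_].
      by rewrite t1.
    * rewrite -doubleS !po B => /andP[_ /negPf n3] /andP[].
      by rewrite n3.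
  + by apply/eqP/setP => k; rewrite !inE; do 2!case: (label T _).
- apply/setP => k; rewrite !inE label_succ.
  by case: (k \in T); case: (label T _).
Qed.

Lemma eoE T : eo T = (\sum_(j < r) (label T j.*2 && label T j.*2.+1))%N.
Proof.
rewrite /eo -sum1_card big_mkcond; apply: eq_bigr => j _.
rewrite inE; have [j0|j0] := posnP j.
  by rewrite j0 /= label0.
have jr := ltn_ord j.
have -> : (labels r [:: j.*2; j.*2.+1] \subset T) =
    label T j.*2 && label T j.*2.+1.
  apply/subsetP/andP => [H|[H1 H2] k].
    by split; apply/labelP;
    [have kr : (j.*2.-1 < r.*2)%N by lia | have kr : (j.*2 < r.*2)%N by lia];
    exists (Ordinal kr) => /=; try lia; apply: H; rewrite !inE /=; lia.
  by rewrite inE -label_succ !inE => /orP[] /eqP ->.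
by rewrite /=; case: (_ && _).
Qed.

Lemma eo_bits_label T :
  eo_bits false (bits T) = eo T.
Proof.
rewrite bits_label eoE; set t := label T.
(* The flag at boundary j is the membership of label 2j, which is false at j = 0. *)
have H k j : eo_bits (t j.*2) [seq t i | i <- iota j.*2.+1 k.*2] =
    (\sum_(j <= i < j + k) (t i.*2 && t i.*2.+1))%N.
  elim: k j => [|k IH] j; first by rewrite addn0 big_geq.
  rewrite doubleS big_ltn ?addnS ?ltnS ?leq_addr //= -addSn -IH.
  by rewrite doubleS.
by have := H r 0%N; rewrite /t label0 => ->; rewrite add0n big_mkord.
Qed.

Lemma calT_accepts T : (T \in calT r) = accepts Free (bits T).
Proof.
have t_out i : (r.*2 < i)%N -> label T i = false by apply: label_out.
have [+ _ _] := accepts_boundary t_out (add0n r).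
rewrite label0 -bits_label => ->//.
apply/calTP/allP => [H j _ //|H j].
(* For j > r both premises in [boundary_ok] fail, as 2j and 2j + 1 exceed 2r. *)
have [jr|jr] := ltnP j r.+1; first by apply: H; rewrite mem_iota.
by rewrite /boundary_ok !(t_out j.*2) ?(t_out j.*2.+1) //; lia.
Qed.

Lemma sum_calT (R : comPzRingType) (C : R) (V : Type) (W : 'I_(r.*2) -> V)
    (f : seq V -> R) :
  \sum_(T in calT r) (-1) ^+ eo T * C ^+ kappa T * f (delete W T) =
  expand C Free f [seq W i | i <- enum 'I_(r.*2)].
Proof.
rewrite expand_bits size_map size_enum_ord ?odd_double // -sum_bits big_mkcond.
apply: eq_bigr => T _; rewrite calT_accepts -delete_bits.
have [-> _ _] := weightE C (bits T); rewrite eo_bits_label card_bits.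
by case: ifP; rewrite ?mul0r.
Qed.

End CalT.

(** * Nondegeneracy of q, and passage to the fraction field of the series ring *)

Lemma qvar_neq0 : qvar != 0.
Proof.
rewrite /qvar tofrac_eq0; apply/eqP => /(congr1 (fun f => fcoef f U_(ord0)%MM)).
by rewrite fcoef0 /= eqxx => /eqP; rewrite oner_eq0.
Qed.

Lemma qvar_expn_neq1 k : (0 < k)%N -> qvar ^+ k != 1.
Proof.
move=> k0; rewrite /qvar -tofracXn -tofrac1 tofrac_eq.
apply/eqP => /(congr1 (fun f => fcoef f 0%MM)); rewrite fcoef1 eqxx => e.
have /(_ 0%MM) := @order_geX 1 rat _ k (@order_ge_fps_var 1 rat ord0).
by rewrite mdeg0 k0 e => /(_ isT) /eqP; rewrite oner_eq0.
Qed.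

Section Fractions.
Variables (K : fieldType) (n : nat).
Local Notation R := (fps n K).

(** The recursions have denominators such as q^M y - q^N, so identities are proved in the fraction
    field and brought back by injectivity of [tofrac]. *)
Definition const_frac : K -> {fraction R} := @tofrac R \o in_alg R.
HB.instance Definition _ := GRing.RMorphism.on const_frac.

Lemma tofracZ (k : K) (f : R) : tofrac (k *: f) = const_frac k * tofrac f.
Proof. by rewrite -mulr_algl tofracM. Qed.

Lemma const_frac_br q m : const_frac (br q m) = 1 - const_frac q ^+ m.
Proof. by rewrite rmorphB rmorph1 rmorphXn. Qed.

(* The variables enter the recursion as q^Y = 1 - <Y> and q^X = 1 - <X>. *)
Definition co_val (f : R) : {fraction R} := 1 - tofrac f.

(** The coefficient at the variable is -k on the left and 0 on the right; this keeps the
    denominators nonzero. *)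
Lemma const_frac_mul_co_val_neq k k' (i : 'I_n) : k != 0 ->
  const_frac k * co_val (fps_var i) != const_frac k'.
Proof.
move=> k0; rewrite /co_val -tofrac1 -tofracB -tofracZ /const_frac /= tofrac_eq.
apply/eqP => /(congr1 (fun f => fcoef f U_(i)%MM)).
rewrite !fcoefZ fcoefD fcoefN fcoef1 /= eqxx -mdeg_eq0 mdeg1 /= mulr0.
by move/eqP; rewrite add0r mulrN1 oppr_eq0 (negPf k0).
Qed.

Lemma co_val_neq k (i : 'I_n) : co_val (fps_var i) != const_frac k.
Proof.
have := const_frac_mul_co_val_neq k i (oner_neq0 K).
by rewrite rmorph1 mul1r.
Qed.

Section Recursion.
Variable q : K.
Hypothesis q_neq0 : q != 0.
Hypothesis q_expn_neq1 : forall m, (0 < m)%N -> q ^+ m != 1.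
Let qF := const_frac q.

Lemma qF_neq0 : qF != 0.
Proof. by rewrite fmorph_eq0. Qed.

Lemma qF_expn_neq1 m : (0 < m)%N -> qF ^+ m != 1.
Proof. by move=> m0; rewrite -rmorphXn fmorph_eq1 q_expn_neq1. Qed.

Lemma tofrac_G_rec eps N M (Y X : 'I_n) (W : seq 'I_n) : (M.+1 < N)%N ->
  let g m U := tofrac (G q eps m N [seq fps_var i | i <- U] : R) in
  g M [:: Y, X & W] = a_factor (qF ^+ M.+1) (qF ^+ N) (co_val (fps_var Y)) *
    (b_factor eps (qF ^+ M.+1) (co_val (fps_var Y)) * g M.+1 [:: Y, X & W]
     + w_factor eps (qF ^+ M.+1) (co_val (fps_var X)) * g M.+1 W).
Proof.
move=> MN /=; have [|J e1 e2] := @G_rec K q eps N n M (fps_var Y) (fps_var X)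
  [seq fps_var i | i <- W] MN.
  by move=> v; rewrite -2!map_cons => /mapP[i _ ->]; apply: order_ge_fps_var.
have sub0 : (0 < N - M.+1)%N by rewrite subn_gt0.
have eN : qF ^+ N = qF ^+ M.+1 * qF ^+ (N - M.+1).
  by rewrite -exprD subnKC // ltnW.
rewrite eN; apply: (@G_rec_solve _ eps _ _ _ _ _ _ _ (tofrac J)).
- by rewrite expf_neq0 // qF_neq0.
- by rewrite qF_expn_neq1.
- by rewrite qF_expn_neq1.
- by rewrite -eN -!rmorphXn const_frac_mul_co_val_neq // expf_neq0.
- by rewrite -rmorphXn co_val_neq.
- move/(congr1 (@tofrac _)): e1.
  rewrite !(tofracM, tofracD, tofracN, tofracZ, tofrac1).
  by rewrite !rmorphM !fmorphV /= !const_frac_br rmorph_nat rmorphXn.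
- move/(congr1 (@tofrac _)): e2.
  rewrite !(tofracM, tofracD, tofracN, tofracZ, tofrac1).
  by rewrite !rmorphM !fmorphV !rmorphXn /= !const_frac_br.
Qed.

(** [a_factor] is homogeneous of degree 0 in u and c, so replacing N by N + 1 amounts to lowering u
    from q^(M+1) to q^M. *)
Lemma a_factor_shift (u c y : {fraction R}) :
  a_factor (qF * u) (qF * c) y = a_factor u c y.
Proof.
rewrite /a_factor -mulrA -!mulrBr -mulf_div divff ?mul1r //; exact: qF_neq0.
Qed.

(** This rests on 1 - <Z + W> = (1 - <Z>)(1 - <W>). *)
Lemma tofrac_boundary_factor N (z w : R) :
  tofrac (br_const q n N - br_add z w) = co_val z * co_val w - qF ^+ N.
Proof.
rewrite /br_const /br_add !(tofracM, tofracD, tofracN) !tofracZ.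
by rewrite tofrac1 mulr1 const_frac_br /co_val; ring.
Qed.

(** The induction needs e arbitrary: it is <M> at first and then <X_i>. The final entry <0> = 0
    matches the value 1 of [head_val] on the empty sequence. *)
Lemma tofrac_shifted_prod N (e : R) (W : seq 'I_n) : ~~ odd (size W) ->
  let E := e :: rcons [seq fps_var i | i <- W] (br_const q n 0) in
  tofrac (\prod_(i < (size W)./2.+1)
    (br_const q n N - br_add E`_(i.*2) E`_((i.*2).+1))) =
  (co_val e * head_val (fun i => co_val (fps_var i)) W - qF ^+ N) *
  shifted_prod (fun i => co_val (fps_var i)) qF N W.
Proof.
elim/seq2_ind: W e => [|Y|Y X W IH] e //=.
  move=> _; rewrite big_ord1 tofrac_boundary_factor /= mulr1.
  by rewrite /br_const /br subrr scale0r {2}/co_val tofrac0 subr0.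
rewrite negbK => oW; rewrite big_ord_recl tofracM tofrac_boundary_factor /=.
congr (_ * _); rewrite -(IH _ oW); congr (tofrac _).
Qed.

Lemma tofrac_Gt eps M N (W : seq 'I_n) :
  tofrac (Gt q eps M N [seq fps_var i | i <- W]) =
  paired (fun i => co_val (fps_var i)) qF N
    (fun m U => tofrac (G q eps m N [seq fps_var i | i <- U])) M W.
Proof.
rewrite /Gt tofracM /paired; congr (_ * _); rewrite size_map.
elim/seq2_ind: W => [|Y|Y X W IH]; rewrite ?big_ord0 ?tofrac1 //=.
rewrite big_ord_recl tofracM tofrac_boundary_factor /=.
by congr (_ * _); rewrite -IH; congr (tofrac _).
Qed.

End Recursion.
End Fractions.

Lemma div_boundary_factor (F : fieldType) (u c y s t : F) :
  (1 - c - (1 - u))^-1 * ((u * y - c) * s * t) = s * t / a_factor u c y.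
Proof.
rewrite /a_factor invf_div (_ : 1 - c - (1 - u) = u - c); last by ring.
by ring.
Qed.

Theorem theorem3p4 (eps : bool) (M N r : nat) (hMN : (M < N)%N) :
  let X : 'I_(r.*2) -> fps r.*2 Qq := fun i => fps_var i in
  (* (X_0, Y_1, X_1, ..., Y_r, X_r, Y_(r+1)) with X_0 = M and Y_(r+1) = 0 *)
  let E := br_const qvar r.*2 M
             :: rcons [seq X i | i <- enum 'I_(r.*2)] (br_const qvar r.*2 0) in
  (br qvar N - br qvar M)^-1 *:
    ((\prod_(i < r.+1)
        (br_const qvar r.*2 N - br_add E`_(i.*2) E`_((i.*2).+1))) *
     G qvar eps M N.+1 [seq X i | i <- enum 'I_(r.*2)])
  = \sum_(T in calT r)
      ((-1) ^+ eo T * (qvar ^+ N / br qvar N ^+ eps) ^+ kappa T) *: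
        Gt qvar eps M N (delete X T).
Proof.
move=> X E; apply/eqP; rewrite -tofrac_eq; apply/eqP.
pose n := r.*2; pose qF := const_frac n qvar.
have q0 := qvar_neq0; have q1 := qvar_expn_neq1.
pose g m (U : seq 'I_n) := tofrac (G qvar eps m N [seq X i | i <- U]).
pose h m (U : seq 'I_n) := tofrac (G qvar eps m N.+1 [seq X i | i <- U]).
pose z (i : 'I_n) := co_val (X i).
have qF0 : qF != 0 := qF_neq0 n q0.
have qF1 : forall m, (0 < m)%N -> qF ^+ m != 1 := qF_expn_neq1 n q1.
have qFX m : qF ^+ m = const_frac n (qvar ^+ m) by rewrite rmorphXn.
have main : shifted z qF N h M (enum 'I_n) =
  expand (qF ^+ N / (1 - qF ^+ N) ^+ eps) Free (paired z qF N g M) (enum 'I_n).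
  apply: (@shifted_expand _ _ z qF N eps qF0 qF1) hMN.
  - by move=> v m; rewrite qFX co_val_neq.
  - move=> v m; rewrite !qFX; apply: const_frac_mul_co_val_neq.
    exact: expf_neq0.
  - by move=> m; rewrite /g G_nil tofrac1.
  - by move=> m; rewrite /h G_nil tofrac1.
  - by move=> m Y Z U ?; rewrite /g /= G_out ?tofrac0.
  - by move=> m Y Z U ?; rewrite /h /= G_out ?tofrac0.
  - by move=> m Y Z U ?; apply: tofrac_G_rec.
  - move=> m Y Z U ?; rewrite /h tofrac_G_rec //.
    by rewrite !exprS a_factor_shift.
  - by rewrite size_enum_ord odd_double.
transitivity (shifted z qF N h M (enum 'I_n)).
  have := @tofrac_shifted_prod _ n qvar N (br_const qvar n M) (enum 'I_n).
  rewrite size_enum_ord odd_double doubleK => /(_ isT) eP.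
  rewrite tofracZ tofracM fmorphV rmorphB /= !const_frac_br eP.
  rewrite {1}/co_val /br_const tofracZ tofrac1 mulr1 const_frac_br subKr.
  exact: div_boundary_factor.
rewrite main -[enum 'I_n]map_id -sum_calT rmorph_sum; apply: eq_bigr => T _ /=.
have -> : delete X T = [seq X i | i <- delete id T].
  by rewrite /delete -map_comp.
rewrite tofracZ; congr (_ * _).
  rewrite rmorphM rmorph_sign rmorphXn fmorph_div /= -qFX.
  congr (_ * (_ / _) ^+ _).
  by rewrite rmorphXn /= const_frac_br.
exact/esym/tofrac_Gt.
Qed.
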